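(* Let $(X,T)$ be a minimal dynamical system and let $d,k\in\mathbb{N}$ with $k\geq 2$. Let $x,x_1,\ldots,x_k\in X$. If $(x,x_i)$ is regionally proximal of order $d$, i.e. $(x,x_i)\in\mathbf{RP}^{[d]}(X)$, for all $1\leq i\leq k$, then the $k$-tuple $(x_1,\ldots,x_k)$ is $k$-regionally proximal of order $d$.
   Context: $\mathbb{N}$ denotes the set of positive integers. A dynamical system $(X,T)$ is a compact metric space $X$ with metric $\rho$ together with a homeomorphism $T:X\to X$. It is minimal if every point $x\in X$ has dense orbit $\{T^nx:n\in\mathbb{Z}\}$. For $\vec n=(n_1,\ldots,n_d)\in\mathbb{Z}^d$ and $\epsilon=(\epsilon(1),\ldots,\epsilon(d))\in\{0,1\}^d$ write $\vec n\cdot\epsilon=\sum_{i=1}^d n_i\epsilon(i)$, and $\vec 0=(0,\ldots,0)$. Regionally proximal relation of order $d$: $(x,y)\in\mathbf{RP}^{[d]}(X)$ if and only if for every $\delta>0$ there exist $x',y'\in X$ and $\vec n\in\mathbb{Z}^d$ such that $\rho(x,x')<\delta$, $\rho(y,y')<\delta$ and $\rho(T^{\vec n\cdot\epsilon}x',T^{\vec n\cdot\epsilon}y')<\delta$ for all $\epsilon\in\{0,1\}^d\setminus\{\vec 0\}$. For $k\geq2$, a $k$-tuple $(x_1,\ldots,x_k)\in X^k$ is $k$-regionally proximal of order $d$ if for any $\delta>0$ there exist $x_i'\in X$, $1\leq i\leq k$, and $\vec n\in\mathbb{Z}^d$ such that $\rho(x_i,x_i')<\delta$ for $1\leq i\leq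 k$ and $\max_{1\leq i<j\leq k}\rho(T^{\vec n\cdot\epsilon}x_i',T^{\vec n\cdot\epsilon}x_j')<\delta$ for all $\epsilon\in\{0,1\}^d\setminus\{\vec 0\}$. *)

(* Defs.v *)
From mathcomp Require Import all_boot all_order all_algebra.
From mathcomp Require Import all_classical all_reals all_analysis.

Set Implicit Arguments.
Unset Strict Implicit.
Unset Printing Implicit Defensive.

Import Order.TTheory GRing.Theory Num.Theory.

Local Open Scope classical_set_scope.
Local Open Scope ring_scope.

Record homeomorphism (X : topologicalType) := Homeomorphism {
  homeo_fun :> X -> X;
  homeo_inv : X -> X;
  homeo_funK : cancel homeo_fun homeo_inv;
  homeo_invK : cancel homeo_inv homeo_fun;
  homeo_continuous : continuous homeo_fun;
  homeo_inv_continuous : continuous homeo_inv }.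

Definition iterz (X : topologicalType) (T : homeomorphism X) (n : int) : X -> X :=
  match n with
  | Posz m => iter m T
  | Negz m => iter m.+1 (homeo_inv T)
  end.

Definition minimal_homeo (X : topologicalType) (T : homeomorphism X) : Prop :=
  forall x : X, dense [set iterz T n x | n in [set: int]].

Definition dotb (d : nat) (n : {ffun 'I_d -> int}) (eps : {ffun 'I_d -> bool}) : int :=
  \sum_(i < d) n i * (eps i)%:R.

Definition regionally_proximal (R : realType) (X : metricType R)
    (T : homeomorphism X) (d : nat) : set (X * X) :=
  [set xy | forall delta : R, 0 < delta ->
    exists (x' y' : X) (n : {ffun 'I_d -> int}),
      [/\ mdist xy.1 x' < delta,
          mdist xy.2 y' < delta &
          forall eps : {ffun 'I_d -> bool}, eps != [ffun=> false] ->
            mdist (iterz T (dotb n eps) x') (iterz T (dotb n eps) y') < delta]].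

(* Distances being nonnegative, the default value 0 of the iterated maximum is
   harmless: for k >= 2 the index set is nonempty. *)
Definition tuple_regionally_proximal (R : realType) (X : metricType R)
    (T : homeomorphism X) (d k : nat) (x : 'I_k -> X) : Prop :=
  forall delta : R, 0 < delta ->
    exists (x' : 'I_k -> X) (n : {ffun 'I_d -> int}),
      (forall i, mdist (x i) (x' i) < delta) /\
      forall eps : {ffun 'I_d -> bool}, eps != [ffun=> false] ->
        \big[Num.max/0]_(p : 'I_k * 'I_k | (p.1 < p.2)%N)
          mdist (iterz T (dotb n eps) (x' p.1)) (iterz T (dotb n eps) (x' p.2))
        < delta.

(* Main.v *)
Require Import Defs.
From mathcomp Require Import all_boot all_order all_algebra.
From mathcomp Require Import all_classical all_reals all_analysis.
From mathcomp Require Import lra.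

(** Let E be the Ellis semigroup of (X, T), the pointwise closure of the powers
    of T, and let L be a minimal left ideal of E.  By minimality of X every
    point y is fixed by some idempotent of L ([ideal_idempotent_fixing]), and
    u v = u whenever u, v lie in L and v is idempotent ([ideal_absorb]).  Fix an
    idempotent u in L with u x = x.

    Consider k copies of the discrete cube, that is the vertices (j, e) with
    j < k and e in {0,1}^d, and the group of all families
    (T^(m_j + n.e))_(j, e), with m in Z^k and n in Z^d, acting on X^vertices.
    Let C be its own Ellis semigroup ([cube_ellis]).  The statement follows once
    C contains an element taking the constant point x to the point whose value
    is x_j at (j, 0) and x at every (j, e) with e <> 0: an approximation of it
    by a group element gives x_j' = T^(m_j) x close to x_j, while every
    T^(n.e) x_j' with e <> 0 is close to x.

    Such an element is built in three moves.

    - Returning ([joint_ellis_return]).  For each p in C some r in C takes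
      u p x back to the constant point x.  Indeed the compact semigroup C u p u
      contains an idempotent s u p u; each of its coordinates is an idempotent
      of L, so u absorbs it and r = u s works.

    - One corner at a time.  Regional proximality of (x, x_j) and compactness
      give p in C whose value at x is x_j at (j, 0), x at the other (i, 0), and
      a_e at (i, e), independent of i ([cube_ellis_proximal_corner]).  Replacing
      the block j by a copy of another one removes x_j; returning from the
      resulting point moves all a_e to x simultaneously.  The same move, applied
      to u p, leaves x everywhere except at (j, 0), where the value is t u x_j
      for some t in E fixing x ([cube_ellis_corner]).  Composing these elements
      over all j only changes the t's ([cube_ellis_corners]).

    - Restoring ([ideal_restore]).  Because t u generates L, some r in E has
      r t u = v with v an idempotent of L fixing x_j, so r t u x_j = x_j, and
      moreover u r x = u v x = x.  Acting by r on the block j gives x_j at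
      (j, 0) and r x at the other vertices of the block; the maps which are the
      identity at the vertices (j, 0) and u elsewhere then turn r x into x.
      These maps belong to C because u is idempotent: applied successively on
      the d faces e(a) = 1, it amounts to u at every nonzero vertex
      ([cube_ellis_off_origin]). *)

Set Implicit Arguments.
Unset Strict Implicit.
Unset Printing Implicit Defensive.

Import Order.TTheory GRing.Theory Num.Theory.

Local Open Scope classical_set_scope.
Local Open Scope ring_scope.

(** * Compact right topological semigroups *)

Lemma bigcap_chain_nonempty (M : topologicalType) (K : set M)
    (F : set (set M)) :
  compact K -> F !=set0 -> total_on F subset ->
  (forall A, F A -> [/\ closed A, A `<=` K & A !=set0]) ->
  \bigcap_(A in F) A !=set0.
Proof.
move=> cK [A0 FA0] chF HF.
have PF : ProperFilter (filter_from F id).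
  apply: filter_from_proper; last by move=> A /HF[].
  apply: filter_from_filter; first by exists A0.
  move=> A B FA FB; have [AB|BA] := chF _ _ FA FB.
    by exists A => // z Az; split=> //; exact: AB.
  by exists B => // z Bz; split=> //; exact: BA.
have [|p [Kp clp]] := cK _ PF; first by exists A0 => //; have [] := HF _ FA0.
exists p => A FA; have [clA _ _] := HF _ FA.
by apply: clA => B pB; apply: clp => //; exists A.
Qed.

(** Zorn's lemma, applied to the complements in K so that the chains of its
    maximality form become unions. *)
Lemma exists_minimal_closed (M : topologicalType) (P : set (set M))
    (K : set M) :
  compact K -> P K -> K !=set0 -> P `<=` closed ->
  (forall F : set (set M), F !=set0 -> F `<=` P -> P (\bigcap_(A in F) A)) ->
  exists A, [/\ P A, A `<=` K, A !=set0 &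
    forall B, P B -> B !=set0 -> B `<=` A -> A `<=` B].
Proof.
move=> cK PK K0 Pcl Pcap.
pose good A := [/\ P A, A `<=` K & A !=set0].
have [F Fgood chF|C [goodC maxC]] :=
    @Zorn_bigcup M [set C | good (K `\` C)].
  have [->|/set0P[C0 FC0]] := eqVneq F set0.
    by rewrite bigcup_set0 /= setD0; split.
  pose G := [set K `\` C | C in F].
  rewrite /=; have -> : K `\` \bigcup_(C in F) C = \bigcap_(A in G) A.
    apply/seteqP; split=> [z [Kz nz] _ [C FC <-]|z Gz].
      by split=> // Cz; apply: nz; exists C.
    split; first by have [] := Gz _ (ex_intro2 _ _ C0 FC0 erefl).
    by case=> C FC Cz; have [] := Gz _ (ex_intro2 _ _ C FC erefl).
  have G0 : G !=set0 by exists (K `\` C0); exists C0.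
  split.
  - by apply: Pcap => // _ [C FC <-]; have [] := Fgood _ FC.
  - by move=> z /(_ _ (ex_intro2 _ _ C0 FC0 erefl)) [].
  apply: (bigcap_chain_nonempty cK G0).
    move=> _ _ [C FC <-] [D FD <-]; have [CD|DC] := chF _ _ FC FD.
      by right; apply: setDS.
    by left; apply: setDS.
  move=> _ [C FC <-]; have [PC CK C1] := Fgood _ FC.
  by split=> //; apply: Pcl.
have [PC CK C1] := goodC; exists (K `\` C); split=> // B PB B0 BC z [Kz nCz].
apply: contrapT => nBz; apply: (maxC (~` B)).
  split; last by move=> /(_ z nBz).
  by move=> y Cy By; have [] := BC _ By.
rewrite /= setDE setCK setIC setIidl; first by split=> // y /BC[].
by move=> y /BC[].
Qed.

(** Used to transport membership in the Ellis semigroups below, where only the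
    group elements then have to be examined. *)
Lemma closure_stable (M N : topologicalType) (f : M -> N) (S : set M)
    (C : set N) :
  continuous f -> closed C -> (forall p, S p -> C (f p)) ->
  forall p, closure S p -> C (f p).
Proof.
move=> cf clC SC p clp; apply: clC => B nB.
by have [q [Sq Bq]] := clp _ (cf p B nB); exists (f q); split=> //; exact: SC.
Qed.

Section RightTopologicalSemigroup.
Context {M : topologicalType} (op : M -> M -> M).
Hypothesis hausM : hausdorff_space M.
Hypothesis opA : associative op.
Hypothesis op_continuousl : forall q, continuous (op^~ q).

Definition subsemigroup (S : set M) := forall p q, S p -> S q -> S (op p q).

Lemma closure_subsemigroup (S : set M) :
  subsemigroup S -> (forall p, S p -> continuous (op p)) ->
  subsemigroup (closure S).
Proof.
move=> SS Sc p q clp clq.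
apply: (closure_stable (f := op^~ q)) clp => //; first exact: closed_closure.
move=> {}p Sp; apply: (closure_stable (f := op p)) clq; first exact: Sc.
  exact: closed_closure.
by move=> {}q Sq; apply/subset_closure/SS.
Qed.

Lemma compact_translate (S : set M) q :
  compact S -> compact [set op p q | p in S].
Proof.
by move=> cS; apply: continuous_compact => //; apply: continuous_subspaceT.
Qed.

(** Ellis and Numakura: in a minimal closed subsemigroup A containing a, both
    A a and the stabilizer of a under left multiplication are closed
    subsemigroups, hence equal to A, and then a a = a. *)
Lemma exists_idempotent (S : set M) :
  compact S -> S !=set0 -> subsemigroup S -> exists2 e, S e & op e e = e.
Proof.
move=> cS S0 SS.
have [||F _ FP|A [[clA AA] AS [a Aa] minA]] :=
    @exists_minimal_closed M (fun A => closed A /\ subsemigroup A) S cS _ S0.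
- by split=> //; exact: compact_closed.
- by move=> A [].
- split; first by apply: closed_bigI => A /FP[].
  by move=> p q Fp Fq A FA; have [_] := FP _ FA; apply; [exact: Fp|exact: Fq].
have cA : compact A by exact: subclosed_compact cS AS.
have Aop p q : A p -> A q -> A (op p q) by exact: AA.
have Aa_sub : [set op p a | p in A] `<=` A by move=> _ [p Ap <-]; exact: Aop.
have [p Ap pa] : [set op p a | p in A] a.
  apply: (minA _ _ _ Aa_sub) => //; last by exists (op a a); exists a.
  split; first by apply: (compact_closed hausM); apply: compact_translate.
  move=> _ _ [p Ap <-] [q Aq <-]; exists (op (op p a) q); last by rewrite !opA.
  exact: Aop (Aop _ _ Ap Aa) Aq.
exists a; first exact: AS.
(* The element p just found is what makes the stabilizer nonempty. *)
have stab : A `<=` A `&` [set q | op q a = a].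
  apply: minA; last by move=> ? [].
    split.
      apply: closedI => //.
      apply: (@preimage_closed _ _ (op^~ a) [set a]).
        by move=> ? _; exact: op_continuousl.
      by apply: (compact_closed hausM); apply: compact_set1.
    move=> q r [Aq qa] [Ar ra]; split; first exact: Aop.
    by rewrite /= -opA ra.
  by exists p.
by have [] := stab _ Aa.
Qed.

(** Every p of a minimal closed left ideal L generates it, because E p is a
    closed left ideal inside L. *)
Lemma exists_minimal_left_ideal (E : set M) :
  compact E -> E !=set0 -> subsemigroup E ->
  exists L, [/\ compact L, L !=set0, L `<=` E,
    forall p q, E p -> L q -> L (op p q) &
    forall p q, L p -> L q -> exists2 r, E r & op r p = q].
Proof.
move=> cE E0 EE.
have [||F _ FP|L [[clL EL] LE L0 minL]] := @exists_minimal_closed M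
    (fun A => closed A /\ forall p q, E p -> A q -> A (op p q)) E cE _ E0.
- by split; [exact: compact_closed|exact: EE].
- by move=> A [].
- split; first by apply: closed_bigI => A /FP[].
  by move=> p q Ep Fq A FA; have [_] := FP _ FA; apply => //; exact: Fq.
exists L; split=> //; first exact: subclosed_compact cE LE.
move=> p q Lp Lq.
have [|||r Er rq] := minL [set op r p | r in E] _ _ _ q Lq.
- split; first by apply: (compact_closed hausM); apply: compact_translate.
  move=> r _ Er [s Es <-]; exists (op r s); last by rewrite opA.
  exact: EE.
- by case: E0 => r Er; exists (op r p); exists r.
- by move=> _ [r Er <-]; exact: EL.
by exists r.
Qed.

End RightTopologicalSemigroup.

(** * Pointwise convergence and powers of a homeomorphism *)

Section Pointwise.
Context {X : topologicalType}.

Lemma ptws_eval_continuous (J : eqType) (j : J) :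
  continuous (fun p : {ptws J -> X} => p j).
Proof. exact: (@proj_continuous J (fun=> X) j). Qed.

Lemma ptws_continuous (A : topologicalType) (J : Type)
    (f : A -> {ptws J -> X}) :
  (forall j, continuous (fun a => f a j)) -> continuous f.
Proof.
move=> cf a; apply/cvg_sup => j B [C [[D oD <-] Dfa] DB].
by apply: filterS DB _; apply: (cf j a); exact: open_nbhs_nbhs.
Qed.

(** Right multiplications in function semigroups, coordinate projections and
    relabellings of coordinates are all of this form. *)
Lemma reindex_continuous (J : eqType) (J' : Type) (s : J' -> J) :
  continuous ((fun p => p \o s) : {ptws J -> X} -> {ptws J' -> X}).
Proof. by apply: ptws_continuous => j; exact: ptws_eval_continuous. Qed.

Lemma compact_ptws (J : eqType) (S : set {ptws J -> X}) :
  compact [set: X] -> closed S -> compact S.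
Proof.
move=> cX clS; apply: (subclosed_compact clS _ (@subsetT _ _)).
rewrite (_ : setT = [set f : {ptws J -> X} | forall j, [set: X] (f j)]).
  exact: (@tychonoff J (fun=> X) (fun=> setT)).
by apply/seteqP; split.
Qed.

Lemma hausdorff_ptws (J : eqType) :
  hausdorff_space X -> hausdorff_space {ptws J -> X}.
Proof. by move=> hX; exact: (@hausdorff_product J (fun=> X)). Qed.

End Pointwise.

Section Iterates.
Context {X : topologicalType} (T : homeomorphism X).

Lemma iterzS n x : iterz T (n + 1) x = T (iterz T n x).
Proof.
case: n => [n|[|n]]; first by rewrite -PoszD addn1.
  by rewrite /= homeo_invK.
rewrite (_ : Negz n.+1 + 1 = Negz n); last first.
    by rewrite !NegzE -[n.+2]addn1 PoszD opprD subrK.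
by rewrite [in RHS]/= homeo_invK.
Qed.

(** The induction on the integers goes both ways; T being injective, its
    step can also be run backwards. *)
Lemma iterzD m n x : iterz T (m + n) x = iterz T m (iterz T n x).
Proof.
have addS k l : iterz T (k + l) x = iterz T k (iterz T l x) ->
    iterz T (k + 1 + l) x = iterz T (k + 1) (iterz T l x).
  by move=> IH; rewrite addrAC !iterzS IH.
have addP k l : iterz T (k + 1 + l) x = iterz T (k + 1) (iterz T l x) ->
    iterz T (k + l) x = iterz T k (iterz T l x).
  by rewrite addrAC !iterzS; exact: (can_inj (homeo_funK T)).
elim/int_rect: m => [|m IH|m IH]; first by rewrite add0r.
  by rewrite -addn1 PoszD; exact: addS.
by apply: addP; rewrite -addn1 PoszD opprD subrK.
Qed.

Lemma iterz_continuous n : continuous (iterz T n).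
Proof.
have it (f : X -> X) m : continuous f -> continuous (iter m f).
  move=> cf; elim: m => [|m IH] x; first exact: cvg_id.
  exact: (continuous_comp (IH x) (cf _)).
case: n => n; [apply: it|apply: (it _ n.+1)].
  exact: homeo_continuous.
exact: homeo_inv_continuous.
Qed.

End Iterates.

(** * The Ellis semigroup and its minimal left ideals *)

Section Metric.
Context {R : realType} {X : metricType R}.

Lemma near_mdist (x : X) (e : R) : 0 < e -> \forall y \near x, mdist x y < e.
Proof. by move=> e0; have := nbhsx_ballx x e e0; rewrite ballEmdist. Qed.

(** A cluster point of the approximate solutions is an exact one. *)
Lemma compact_exact_solution (M : topologicalType) (K : set M) (J : Type)
    (f g : J -> M -> X) :
  compact K -> (forall j, continuous (f j)) -> (forall j, continuous (g j)) ->
  (forall e : R, 0 < e ->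
     exists2 p, K p & forall j, mdist (f j p) (g j p) < e) ->
  exists2 p, K p & forall j, f j p = g j p.
Proof.
move=> cK cf cg sol.
(* The approximate solutions are decreasing in e, so they generate a filter. *)
pose G (e : R) := K `&` [set p | forall j, mdist (f j p) (g j p) < e].
have PF : ProperFilter (filter_from [set e : R | 0 < e] G).
  apply: filter_from_proper; last by move=> e /sol[p Kp pe]; exists p.
  apply: filter_from_filter; first by exists 1; rewrite /= ltr01.
  move=> a b /= a0 b0; exists (Num.min a b) => /=.
    by rewrite lt_min a0.
  move=> p [Kp pab]; split; split=> // j; have := pab j; rewrite lt_min.
    by case/andP.
  by case/andP.
have [|p [Kp clp]] := cK _ PF; first by exists 1; [exact: ltr01|move=> ? []].
exists p => // j; apply: mdist_positivity; apply/eqP; rewrite eq_le mdist_ge0.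
rewrite andbT; apply/ler_addgt0Pl => e e0; rewrite addr0.
(* Three distances are to be added in the triangle inequality. *)
have e3 : 0 < e / 3%:R by rewrite divr_gt0.
have [q [[_ /(_ j) fgq] [fq gq]]] : G (e / 3%:R) `&`
    [set q | mdist (f j p) (f j q) < e / 3%:R /\
             mdist (g j p) (g j q) < e / 3%:R] !=set0.
  apply: clp; first by exists (e / 3%:R).
  have nf : \forall q \near p, mdist (f j p) (f j q) < e / 3%:R.
    exact: cf j p _ (near_mdist (f j p) e3).
  have ng : \forall q \near p, mdist (g j p) (g j q) < e / 3%:R.
    exact: cg j p _ (near_mdist (g j p) e3).
  exact: filterI nf ng.
have := metric_triangle (f j p) (f j q) (g j p).
have := metric_triangle (f j q) (g j q) (g j p).
rewrite (metric_sym (g j q)); lra.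
Qed.

End Metric.

Section EnvelopingSemigroup.
Context {R : realType} {X : metricType R} (T : homeomorphism X).
Hypothesis cptX : compact [set: X].

Definition ellis : set {ptws X -> X} :=
  closure [set (iterz T n : {ptws X -> X}) | n in [set: int]].

Definition compose (p q : {ptws X -> X}) : {ptws X -> X} := p \o q.

Lemma composeA : associative compose. Proof. by []. Qed.

Lemma compose_continuousl q : continuous (compose^~ q).
Proof. exact: (@reindex_continuous X X X q). Qed.

Let hausM : hausdorff_space {ptws X -> X}.
Proof. exact/hausdorff_ptws/metric_hausdorff. Qed.

Lemma ellis_iterz n : ellis (iterz T n).
Proof. by apply: subset_closure; exists n. Qed.

Lemma ellis_id : ellis id.
Proof. by rewrite (_ : id = iterz T 0); [exact: ellis_iterz|exact/funext]. Qed.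

Lemma compact_ellis : compact ellis.
Proof. by apply: compact_ptws => //; exact: closed_closure. Qed.

Lemma ellis_compose : subsemigroup compose ellis.
Proof.
apply: closure_subsemigroup; first exact: compose_continuousl.
  move=> _ _ [m _ <-] [n _ <-]; exists (m + n) => //.
  by apply/funext => y; exact: iterzD.
move=> _ [n _ <-]; apply: ptws_continuous => y q.
apply: (@continuous_comp _ _ _ (fun p : {ptws X -> X} => p y) (iterz T n)).
  exact: ptws_eval_continuous.
exact: iterz_continuous.
Qed.

(** The image of E under evaluation at y is compact and contains the orbit. *)
Lemma ellis_transitive : minimal_homeo T ->
  forall y z, exists2 p, ellis p & p y = z.
Proof.
move=> minT y z; pose O := [set p y | p in ellis].
have clO : closed O.
  apply: (compact_closed (@metric_hausdorff _ X)).
  apply: (continuous_compact _ compact_ellis); apply: continuous_subspaceT.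
  exact: ptws_eval_continuous.
suff : O z by case=> p; exists p.
apply: clO => B /nbhs_interior nB.
have [||w [Bw [n _ nw]]] := minT y B°.
    by exists z; exact: nbhs_singleton.
  exact: open_interior.
exists w; split; last exact: interior_subset.
by rewrite -nw; exists (iterz T n) => //; exact: ellis_iterz.
Qed.

Definition minimal_left_ideal (L : set {ptws X -> X}) :=
  [/\ compact L, L !=set0, L `<=` ellis,
    forall p q, ellis p -> L q -> L (compose p q) &
    forall p q, L p -> L q -> exists2 r, ellis r & compose r p = q].

Lemma exists_ellis_ideal : exists L, minimal_left_ideal L.
Proof.
apply: exists_minimal_left_ideal => //.
- exact: compose_continuousl.
- exact: compact_ellis.
- by exists id; exact: ellis_id.
- exact: ellis_compose.
Qed.

Section Ideal.
Variable L : set {ptws X -> X}.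
Hypothesis idealL : minimal_left_ideal L.

Lemma ideal_idempotent_fixing : minimal_homeo T ->
  forall y, exists v, [/\ L v, compose v v = v & v y = y].
Proof.
move=> minT y; have [cL [q Lq] LE EL _] := idealL.
have [|||v [Lv vy] vv] :=
    @exists_idempotent _ compose hausM composeA compose_continuousl
      (L `&` [set p | p y = y]).
- apply: compact_closedI => //.
  apply: (@preimage_closed _ _ (fun p : {ptws X -> X} => p y) [set y]).
    by move=> p _; exact: ptws_eval_continuous.
  by apply: (compact_closed (@metric_hausdorff _ X)); exact: compact_set1.
- have [r Er ry] := ellis_transitive minT (q y) y.
  by exists (compose r q); split; [exact: EL|].
- move=> p r [Lp py] [Lr ry]; split; first by apply: EL => //; exact: LE.
  by rewrite /compose /= ry.
by exists v.
Qed.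

(** Since v generates L, u = r v for some r, and right multiplication by the
    idempotent v fixes r v. *)
Lemma ideal_absorb u v : L u -> L v -> compose v v = v -> compose u v = u.
Proof.
move=> Lu Lv vv; have [_ _ _ _ gen] := idealL.
by have [r _ <-] := gen _ _ Lv Lu; rewrite -composeA vv.
Qed.

(** The map t may well not be injective on X, but t u generates L and so
    nothing of u y is lost.  The second conclusion comes for free: as t u fixes
    x, the value r x is v x for an idempotent v of L, which u absorbs. *)
Lemma ideal_restore u t x y : minimal_homeo T ->
  L u -> u x = x -> ellis t -> t x = x ->
  exists2 r, ellis r & r (t (u y)) = y /\ u (r x) = x.
Proof.
move=> minT Lu ux Et tx; have [_ _ _ EL gen] := idealL.
have [v [Lv vv vy]] := ideal_idempotent_fixing minT y.
have [r Er rtu] := gen _ _ (EL _ _ Et Lu) Lv.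
have rtuE z : r (t (u z)) = v z by rewrite -rtu.
exists r => //; split; first by rewrite rtuE.
have uv z : u (v z) = u z by rewrite -[in RHS](ideal_absorb Lu Lv vv).
by rewrite -[X in r X]tx -[X in r (t X)]ux rtuE uv.
Qed.

End Ideal.
End EnvelopingSemigroup.

(** * Ellis semigroups of groups acting on powers of X *)

Section ProductSemigroup.
Context {R : realType} {X : metricType R} (T : homeomorphism X).
Hypothesis cptX : compact [set: X].
Context {I : choiceType} (W : set (I -> int)).
Hypothesis WD : forall v w, W v -> W w -> W (fun i => v i + w i).

(** A family w of exponents acts on a point of X^I by T^(w i) on the
    coordinate i.  Families of maps of X indexed by I are uncurried, so that
    they live in a single space with the pointwise topology. *)
Definition coord_shift (w : I -> int) : {ptws I * X -> X} :=
  fun z => iterz T (w z.1) z.2.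

Definition joint_ellis : set {ptws I * X -> X} :=
  closure [set coord_shift w | w in W].

Definition coord_compose (p q : {ptws I * X -> X}) : {ptws I * X -> X} :=
  fun z => p (z.1, q z).

Lemma coord_composeA : associative coord_compose. Proof. by []. Qed.

Lemma coord_compose_continuousl q : continuous (coord_compose^~ q).
Proof.
exact: (@reindex_continuous X (I * X)%type (I * X)%type (fun z => (z.1, q z))).
Qed.

Lemma joint_ellis_shift w : W w -> joint_ellis (coord_shift w).
Proof. by move=> Ww; apply: subset_closure; exists w. Qed.

Lemma compact_joint_ellis : compact joint_ellis.
Proof. by apply: compact_ptws => //; exact: closed_closure. Qed.

Lemma joint_ellis_coord_compose : subsemigroup coord_compose joint_ellis.
Proof.
apply: closure_subsemigroup; first exact: coord_compose_continuousl.
  move=> _ _ [v Wv <-] [w Ww <-]; exists (fun i => v i + w i); first exact: WD.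
  by apply/funext => z; exact: iterzD.
move=> _ [w _ <-]; apply: ptws_continuous => z q.
apply: (@continuous_comp _ _ _ (fun p : {ptws I * X -> X} => p z)
          (iterz T (w z.1))).
  exact: ptws_eval_continuous.
exact: iterz_continuous.
Qed.

Lemma joint_ellis_coord p i : joint_ellis p -> ellis T (fun y => p (i, y)).
Proof.
apply: (closure_stable
    (f := (fun p y => p (i, y)) : {ptws I * X -> X} -> {ptws X -> X})).
- exact: (@reindex_continuous X (I * X)%type X (pair i)).
- exact: closed_closure.
- by move=> _ [w _ <-]; exact: (@ellis_iterz _ _ T (w i)).
Qed.

(** Extending a map of X by the identity off S is continuous in that map, and
    takes T^n to the group element with exponent n on S and 0 off S. *)
Lemma joint_ellis_restrict (S : pred I) p :
  (forall n, W (fun i => if S i then n else 0)) -> ellis T p ->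
  joint_ellis (fun z => if S z.1 then p z.2 else z.2).
Proof.
move=> WS; apply: (closure_stable
    (f := (fun p z => if S z.1 then p z.2 else z.2) :
      {ptws X -> X} -> {ptws I * X -> X})).
- apply: ptws_continuous => z; case: (S z.1) => q.
    exact: ptws_eval_continuous.
  exact: cst_continuous.
- exact: closed_closure.
move=> _ [n _ <-]; rewrite (_ : (fun _ => _) =
  coord_shift (fun i => if S i then n else 0)).
  exact: joint_ellis_shift.
by apply/funext => z; rewrite /coord_shift; case: (S z.1).
Qed.

Lemma joint_ellis_relabel (s : I -> I) p :
  (forall w, W w -> W (w \o s)) -> joint_ellis p ->
  joint_ellis (fun z => p (s z.1, z.2)).
Proof.
move=> Ws; apply: (closure_stable (f := (fun p z => p (s z.1, z.2))
    : {ptws I * X -> X} -> {ptws I * X -> X})).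
- exact: (@reindex_continuous X (I * X)%type (I * X)%type
           (fun z => (s z.1, z.2))).
- exact: closed_closure.
by move=> _ [w Ww <-]; exact: (joint_ellis_shift (Ws w Ww)).
Qed.

Section Return.
Hypothesis Wdiag : forall n, W (fun=> n).

Lemma joint_ellis_diag p : ellis T p -> joint_ellis (fun z => p z.2).
Proof. exact: (@joint_ellis_restrict predT). Qed.

(** The orbit closure of the diagonal is minimal: on each coordinate, an
    idempotent of the product semigroup of the form s u p u is an idempotent of
    L, and u absorbs it. *)
Lemma joint_ellis_return L u p x :
  minimal_left_ideal T L -> L u -> compose u u = u -> u x = x ->
  joint_ellis p ->
  exists2 r, joint_ellis r & forall i, r (i, u (p (i, x))) = x.
Proof.
move=> idL Lu uu ux Ep; have [_ _ LE EL _] := idL.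
pose du : {ptws I * X -> X} := fun z => u z.2.
have Edu : joint_ellis du by apply: joint_ellis_diag; exact: LE.
(* Multiplying by du on the right is what puts the coordinates in L. *)
pose b := coord_compose du (coord_compose p du).
have Eb : joint_ellis b by do 2?apply: joint_ellis_coord_compose.
have [||||_ [s Es <-]] := @exists_idempotent _ coord_compose _ coord_composeA
    coord_compose_continuousl [set coord_compose s b | s in joint_ellis].
- exact/hausdorff_ptws/metric_hausdorff.
- apply: compact_translate; last exact: compact_joint_ellis.
  exact: coord_compose_continuousl.
- by exists (coord_compose b b); exists b.
- move=> _ _ [s Es <-] [t Et <-];
  exists (coord_compose (coord_compose s b) t) => //.
  by apply: joint_ellis_coord_compose => //; apply: joint_ellis_coord_compose.
move=> idem; exists (coord_compose du s).
  exact: joint_ellis_coord_compose.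
move=> i; pose v : {ptws X -> X} := fun y => s (i, u (p (i, u y))).
have vv : compose v v = v.
  by apply/funext => y; exact: (congr1 (fun g => g (i, y)) idem).
have Lv : L v.
  apply: (EL (fun y => s (i, u (p (i, y)))) u) => //.
  apply: (@ellis_compose _ _ T (fun y => s (i, y)) (fun y => u (p (i, y)))).
    exact: joint_ellis_coord.
  apply: (@ellis_compose _ _ T u (fun y => p (i, y))); first exact: LE.
  exact: joint_ellis_coord.
have : u (v x) = u x by rewrite -[in RHS](ideal_absorb idL Lu Lv vv).
by rewrite /v /coord_compose /du /= !ux.
Qed.

End Return.

Lemma joint_ellis_approx (J : finType) (c : J -> I) p x (e : R) :
  joint_ellis p -> 0 < e ->
  exists2 w, W w & forall j, mdist (p (c j, x)) (iterz T (w (c j)) x) < e.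
Proof.
move=> clp e0.
have nj j : \forall q \near p, mdist (p (c j, x)) (q (c j, x)) < e.
  exact: (@ptws_eval_continuous X (I * X)%type (c j, x) p _
            (near_mdist (p (c j, x)) e0)).
have [_ [[w Ww <-] /= we]] := clp _ (filter_forall (nbhs_filter p) nj).
by exists w.
Qed.

End ProductSemigroup.

(** * Blocks of cubes *)

Section CubeRates.
Variables d k : nat.

Definition origin : {ffun 'I_d -> bool} := [ffun=> false].

Definition vertex := ('I_k * {ffun 'I_d -> bool})%type.

(** The exponents of the group generated by the face transformations of the
    cube, acting on all blocks at once, and by T acting on any single block. *)
Definition cube_rates : set (vertex -> int) :=
  [set w | exists (m : 'I_k -> int) (n : {ffun 'I_d -> int}),
    w = fun i => m i.1 + dotb n i.2].

Lemma dotb_origin n : dotb n origin = 0.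
Proof. by rewrite /dotb big1 // => a _; rewrite ffunE mulr0. Qed.

Lemma dotb0 (e : {ffun 'I_d -> bool}) : dotb [ffun=> 0] e = 0.
Proof. by rewrite /dotb big1 // => a _; rewrite ffunE mul0r. Qed.

Lemma cube_ratesD v w :
  cube_rates v -> cube_rates w -> cube_rates (fun i => v i + w i).
Proof.
move=> [m [n ->]] [m' [n' ->]]; exists (fun j => m j + m' j).
exists [ffun a => n a + n' a]; apply/funext => i.
rewrite addrACA; congr (_ + _).
by rewrite /dotb -big_split; apply: eq_bigr => a _; rewrite ffunE mulrDl.
Qed.

Lemma cube_rates_blocks (m : 'I_k -> int) : cube_rates (fun i => m i.1).
Proof.
by exists m, [ffun=> 0]; apply/funext => i; rewrite dotb0 addr0.
Qed.

Lemma cube_rates_face (a : 'I_d) n :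
  cube_rates (fun i => if i.2 a then n else 0).
Proof.
exists (fun=> 0), [ffun b => if b == a then n else 0]; apply/funext => i.
rewrite add0r /dotb (bigD1 a) //= ffunE eqxx big1 ?addr0 => [|b /negbTE ba].
  by case: (i.2 a); rewrite ?mulr1 ?mulr0.
by rewrite ffunE ba mul0r.
Qed.

Lemma cube_rates_relabel (s : 'I_k -> 'I_k) w :
  cube_rates w -> cube_rates (w \o fun i => (s i.1, i.2)).
Proof. by move=> [m [n ->]]; exists (m \o s), n. Qed.

Section Dynamics.
Context {R : realType} {X : metricType R} (T : homeomorphism X).
Hypothesis cptX : compact [set: X].
Hypothesis minT : minimal_homeo T.

Definition cube_ellis := joint_ellis T cube_rates.

Let cubeM p q : cube_ellis p -> cube_ellis q -> cube_ellis (coord_compose p q).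
Proof. by apply: joint_ellis_coord_compose => *; exact: cube_ratesD. Qed.

(** Each P j can be applied on the block j alone; composing these elements over
    the finitely many blocks gives the whole family. *)
Lemma cube_ellis_blocks (P : 'I_k -> X -> X) :
  (forall j, ellis T (P j)) -> cube_ellis (fun z => P z.1.1 z.2).
Proof.
move=> EP.
suff H (s : seq 'I_k) : uniq s ->
    cube_ellis (fun z => if z.1.1 \in s then P z.1.1 z.2 else z.2).
  have := H _ (enum_uniq 'I_k); congr (cube_ellis _); apply/funext => z.
  by rewrite mem_enum.
elim: s => [_|j s IH /= /andP[js us]].
  exact: (@joint_ellis_restrict _ _ _ _ _ pred0 _
           (fun=> cube_rates_blocks (fun=> 0)) (ellis_id T)).
have Ej := @joint_ellis_restrict _ _ T _ cube_rates (fun i => i.1 == j) _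
  (fun n => cube_rates_blocks (fun j' => if j' == j then n else 0)) (EP j).
have := cubeM Ej (IH us); congr (cube_ellis _); apply/funext => z.
rewrite /coord_compose /= inE; case: eqP => [->|_] //=.
by rewrite (negbTE js).
Qed.

(** Applying u successively on the d faces e(a) = 1 applies it at least once at
    every nonzero vertex, and applying the idempotent u several times is the
    same as applying it once. *)
Lemma cube_ellis_off_origin u : ellis T u -> compose u u = u ->
  cube_ellis (fun z => if z.1.2 == origin then z.2 else u z.2).
Proof.
move=> Eu uu.
suff H (s : seq 'I_d) :
    cube_ellis (fun z => if has z.1.2 s then u z.2 else z.2).
  have := H (enum 'I_d); congr (cube_ellis _); apply/funext => z.
  case: eqP => [->|ne].
    by rewrite (eq_has (a2 := pred0)) ?has_pred0 // => a; rewrite ffunE.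
  case: ifPn => // /hasPn nz; case: ne; apply/ffunP => a.
  by rewrite ffunE; apply/negbTE/nz; rewrite mem_enum.
elim: s => [|a s IH].
  exact: (@joint_ellis_restrict _ _ _ _ _ pred0 _
           (fun=> cube_rates_blocks (fun=> 0)) (ellis_id T)).
have Ea := @joint_ellis_restrict _ _ T _ cube_rates (fun i => i.2 a) _
  (cube_rates_face a) Eu.
have := cubeM Ea IH; congr (cube_ellis _); apply/funext => z.
have uuE y : u (u y) = u y := congr1 (fun g => g y) uu.
by rewrite /coord_compose /=; case: (z.1.2 a); case: has; rewrite //= uuE.
Qed.

(** Starting from witnesses x', y' of regional proximality, y' is replaced by a
    nearby T^m x'; the cubes of x' on the blocks i <> j and of T^m x' on the
    block j then approximately satisfy the required equations, which hold
    exactly in the limit.  The common values at the nonzero vertices are not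
    prescribed, so they are those of the block j itself. *)
Lemma cube_ellis_proximal_corner j x y : regionally_proximal T d (x, y) ->
  exists2 p, cube_ellis p & forall i, p (i, x) =
    if i.2 == origin then (if i.1 == j then y else x) else p ((j, i.2), x).
Proof.
move=> RPxy.
apply: (compact_exact_solution (K := cube_ellis)
  (f := fun i (p : {ptws vertex * X -> X}) => p (i, x))
  (g := fun i (p : {ptws vertex * X -> X}) =>
    if i.2 == origin then (if i.1 == j then y else x) else p ((j, i.2), x))).
- exact: compact_joint_ellis.
- by move=> i; exact: ptws_eval_continuous.
- move=> i; case: (_ == origin); first exact: cst_continuous.
  exact: ptws_eval_continuous.
move=> e e0; have e2 : 0 < e / 2%:R by rewrite divr_gt0.
have [x' [y' [n [/= xx' yy' close]]]] := RPxy _ e2.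
have near_y' : \forall z \near y', mdist y' z < e / 2%:R /\
    forall eps : {ffun 'I_d -> bool},
      mdist (iterz T (dotb n eps) y') (iterz T (dotb n eps) z) < e / 2%:R.
  apply: filterI; first exact: near_mdist.
  apply: filter_forall => eps.
  exact: (@iterz_continuous X T _ y' _ (near_mdist _ e2)).
have [||z [/interior_subset zO [m _ mz]]] :=
    minT x' (O := (fun z => mdist y' z < e / 2%:R /\
    forall eps : {ffun 'I_d -> bool},
      mdist (iterz T (dotb n eps) y') (iterz T (dotb n eps) z) < e / 2%:R)°).
- by exists y'.
- exact: open_interior.
move: zO; rewrite -mz => -[y'z close'].
have [p Ep px] := ellis_transitive cptX minT x x'.
pose w : vertex -> int := fun i => (if i.1 == j then m else 0) + dotb n i.2.
have Ew : cube_ellis (coord_shift T w).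
  by apply: joint_ellis_shift; exists (fun j' => if j' == j then m else 0), n.
have Ed : cube_ellis (fun z => p z.2).
  exact: (cube_ellis_blocks (P := fun=> p)).
exists (coord_compose (coord_shift T w) (fun z => p z.2)); first exact: cubeM.
move=> [i eps]; rewrite /coord_compose /coord_shift /w /= px eqxx.
have [->|ne] := eqVneq eps origin.
  rewrite dotb_origin addr0; case: eqP => _.
    have := metric_triangle y y' (iterz T m x').
    rewrite (metric_sym (iterz T m x')); lra.
  by rewrite metric_sym /=; lra.
case: eqP => _; first by rewrite mdistxx.
rewrite add0r addrC iterzD.
have := metric_triangle (iterz T (dotb n eps) x') (iterz T (dotb n eps) y')
  (iterz T (dotb n eps) (iterz T m x')).
have := close _ ne; have := close' eps; lra.
Qed.

Section Assembly.
Variables (L : set {ptws X -> X}) (u : {ptws X -> X}) (x : X).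
Hypothesis idL : minimal_left_ideal T L.
Hypothesis Lu : L u.
Hypothesis uu : compose u u = u.
Hypothesis ux : u x = x.

Let Eu : ellis T u. Proof. by have [_ _ LE _ _] := idL; exact: LE. Qed.

(** The point p x differs at (j, origin) only from the point p' x in which the
    block j is replaced by a copy of another block j'.  An element r returning
    from u p' x therefore takes u p x to x at all other vertices; its component
    at (j, origin) is t. *)
Lemma cube_ellis_corner j y : (1 < k)%N -> regionally_proximal T d (x, y) ->
  exists s t, [/\ cube_ellis s, ellis T t, t x = x,
    s ((j, origin), x) = t (u y) &
    forall i, i != (j, origin) -> s (i, x) = x].
Proof.
move=> k_gt1 /(cube_ellis_proximal_corner j) [p Ep px].
have [j' j'j] : exists j', j' != j.
  have [j0|j0] := eqVneq j (Ordinal (ltnW k_gt1)).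
    by exists (Ordinal k_gt1); rewrite j0.
  by exists (Ordinal (ltnW k_gt1)); rewrite eq_sym.
have Ep' : cube_ellis
    (fun z => p ((if z.1.1 == j then j' else z.1.1, z.1.2), z.2)).
  apply: (joint_ellis_relabel
    (s := fun i : vertex => (if i.1 == j then j' else i.1, i.2))) Ep => w.
  exact: (cube_rates_relabel (fun i => if i == j then j' else i)).
have Wdiag n : cube_rates (fun=> n) by exact: (cube_rates_blocks (fun=> n)).
have [r Er rx] := joint_ellis_return cptX cube_ratesD Wdiag idL Lu uu ux Ep'.
have ne_j i : (if i == j then j' else i) == j = false.
  by case: (eqVneq i j) => [_|/negbTE //]; exact/negbTE.
have Edu : cube_ellis (fun z => u z.2).
  exact: (cube_ellis_blocks (P := fun=> u)).
exists (coord_compose r (coord_compose (fun z => u z.2) p)).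
exists (fun z => r ((j, origin), z)).
split.
- by apply: (cubeM Er); exact: cubeM.
- exact: (joint_ellis_coord (i := (j, origin)) Er).
- have := rx (j, origin); rewrite /= px /= eqxx ne_j ux; exact.
- by rewrite /coord_compose /= px /= !eqxx.
move=> [i e] ne; rewrite -[RHS](rx (i, e)) /coord_compose /=.
congr (r (_, u _)); rewrite [LHS]px [RHS]px /= ne_j.
case: (eqVneq e origin) ne => [->|//].
by case: (eqVneq i j) => [->|//]; rewrite eqxx.
Qed.

(** An element making a corner at j0 fixes x at every other vertex, so it
    preserves the corners already made up to changing their maps t. *)
Lemma cube_ellis_corners (xs : 'I_k -> X) : (1 < k)%N ->
  (forall j, regionally_proximal T d (x, xs j)) ->
  exists2 c, cube_ellis c &
    (forall j e, e != origin -> c ((j, e), x) = x) /\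
    forall j, exists t, [/\ ellis T t, t x = x &
      c ((j, origin), x) = t (u (xs j))].
Proof.
move=> k_gt1 RPx.
suff H : forall s : seq 'I_k, uniq s -> exists2 c, cube_ellis c &
    (forall j e, (e != origin) || (j \notin s) -> c ((j, e), x) = x) /\
    forall j, j \in s -> exists t, [/\ ellis T t, t x = x &
      c ((j, origin), x) = t (u (xs j))].
  have [c Ec [cx ct]] := H _ (enum_uniq 'I_k).
  exists c => //; split=> [j e ne|j]; first by apply: cx; rewrite ne.
  by apply: ct; rewrite mem_enum.
elim=> [_|j0 s IH /= /andP[j0s /IH[c Ec [cx ct]]]].
  exists (fun z => z.2) => //.
  exact: (cube_ellis_blocks (P := fun=> id) (fun=> ellis_id T)).
have [q [t [Eq Et tx qt qx]]] := cube_ellis_corner j0 k_gt1 (RPx j0).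
exists (coord_compose q c); first exact: cubeM.
rewrite /coord_compose /=; split=> [j e|j].
  rewrite inE negb_or => jes; rewrite cx.
    apply: qx; apply: contraTneq jes => -[-> ->].
    by rewrite !eqxx.
  by case/orP: jes => [->//|/andP[_ ->]]; rewrite orbT.
rewrite inE; have [-> _|j_j0 /= js] := eqVneq j j0.
  by exists t; rewrite cx ?j0s ?orbT.
have [t' [Et' t'x ->]] := ct j js.
exists (fun z => q ((j, origin), t' z)); split=> //.
  exact: (ellis_compose (p := fun z => q ((j, origin), z))
            (joint_ellis_coord (i := (j, origin)) Eq) Et').
by rewrite t'x qx // xpair_eqE negb_and j_j0.
Qed.

Lemma cube_ellis_proximal_tuple (xs : 'I_k -> X) : (1 < k)%N ->
  (forall j, regionally_proximal T d (x, xs j)) ->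
  exists2 c, cube_ellis c &
    forall j e, c ((j, e), x) = if e == origin then xs j else x.
Proof.
move=> k_gt1 RPx; have [c Ec [cx ct]] := cube_ellis_corners k_gt1 RPx.
have /choice[r Hr] : forall j, exists r : X -> X, [/\ ellis T r,
    r (c ((j, origin), x)) = xs j & u (r x) = x].
  move=> j; have [t [Et tx ->]] := ct j.
  have [r Er [rt ur]] := ideal_restore cptX idL (xs j) minT Lu ux Et tx.
  by exists r.
have Er : cube_ellis (fun z => r z.1.1 z.2).
  by apply: cube_ellis_blocks => j; have [] := Hr j.
exists (coord_compose (fun z => if z.1.2 == origin then z.2 else u z.2)
         (coord_compose (fun z => r z.1.1 z.2) c)).
  by apply: cubeM (cubeM Er Ec); exact: cube_ellis_off_origin.
move=> j e; have [_ rxs ur] := Hr j; rewrite /coord_compose /=.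
by have [->|ne] := eqVneq e origin; [|rewrite cx].
Qed.

End Assembly.

End Dynamics.
End CubeRates.

Theorem theorem3p2 (R : realType) (X : metricType R)
    (cptX : compact [set: X]) (T : homeomorphism X) (minT : minimal_homeo T)
    (d k : nat) (d_gt0 : (0 < d)%N) (k_ge2 : (2 <= k)%N)
    (x : X) (xs : 'I_k -> X)
    (RPx : forall i : 'I_k, regionally_proximal T d (x, xs i)) :
  tuple_regionally_proximal T d xs.
Proof.
have [L idL] := exists_ellis_ideal T cptX.
have [u [Lu uu ux]] := ideal_idempotent_fixing cptX idL minT x.
have [c Ec cx] :=
  cube_ellis_proximal_tuple cptX minT idL Lu uu ux k_ge2 RPx.
move=> e e0; have e2 : 0 < e / 2%:R by rewrite divr_gt0.
have [_ [m [n ->]] /= approx] := joint_ellis_approx id x Ec e2.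
exists (fun j => iterz T (m j) x), n; split=> [j|eps ne].
  have := approx (j, origin d); rewrite cx eqxx dotb_origin addr0 /=; lra.
rewrite -big_filter; elim/big_ind: _ => // [a b ae be|[i j] _].
  by rewrite gt_max ae.
have near_x l : mdist x (iterz T (dotb n eps) (iterz T (m l) x)) < e / 2%:R.
  by have := approx (l, eps); rewrite cx (negbTE ne) /= addrC iterzD.
have := metric_triangle (iterz T (dotb n eps) (iterz T (m i) x)) x
  (iterz T (dotb n eps) (iterz T (m j) x)).
rewrite metric_sym [mdist _ x]metric_sym.
have := near_x i; have := near_x j => /=; lra.
Qed.
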